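(* Let $f$ be a smooth height function of a surface in a local orthonormal $uvw$ coordinate system, and let the transformation from the local to the global coordinate system be $\mathbf{x}=\mathbf{Q}\mathbf{u}+\mathbf{x}_0$ (with $\mathbf{Q}$ a $3\times3$ orthogonal matrix whose columns are the local axes, $\mathbf{u}=[u,v,w]^T$ local coordinates). At a point of the surface, let $\ell=\sqrt{1+f_u^2+f_v^2}$, let $\mathbf{H}$ be the Hessian of $f$, $\mathbf{B}=\mathbf{H}/\ell$ the second fundamental matrix, $\mathbf{J}$ the $3\times 2$ Jacobian of $(u,v)\mapsto[u,v,f(u,v)]^T$, and $\mathbf{J}_g=\mathbf{Q}\mathbf{J}$. Then the curvature tensors $\mathbf{C}$ and $\mathbf{C}_g$ in the local and global coordinate systems are, respectively, $$\mathbf{C}=\mathbf{J}^{+T}\mathbf{B}\mathbf{J}^{+}=\frac1\ell\mathbf{J}^{+T}\mathbf{H}\mathbf{J}^{+},\qquad \mathbf{C}_g=\mathbf{J}_g^{+T}\mathbf{B}\mathbf{J}_g^{+}=\frac1\ell\mathbf{J}_g^{+T}\mathbf{H}\mathbf{J}_g^{+},$$ where $$\mathbf{J}^{+}=\frac1{\ell^2}\begin{bmatrix}1+f_v^2&-f_uf_v&f_u\\-f_uf_v&1+f_u^2&f_v\end{bmatrix}$$ is the pseudo-inverse of $\mathbf{J}$, and $\mathbf{J}_g^{+}=\mathbf{J}^{+}\mathbf{Q}^T$ is the pseudo-inverse of $\mathbf{J}_g$. In addition, $\mathbf{H}=\ell\,\mathbf{J}^T\mathbf{C}\mathbf{J}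=\ell\,\mathbf{J}_g^T\mathbf{C}_g\mathbf{J}_g$.
   Context: A height function is a smooth function $f$ from an open subset of $\mathbb{R}^2$ to $\mathbb{R}$ whose graph $\mathbf{p}(u,v)=[u,v,f(u,v)]^T$ describes the surface in the local frame; the local and global frames are both orthonormal and right-handed. Put $\mathbf{p}_u=[1,0,f_u]^T$, $\mathbf{p}_v=[0,1,f_v]^T$, $\mathbf{J}=[\mathbf{p}_u\mid\mathbf{p}_v]$. The Weingarten matrix (shape operator in the basis $\{\mathbf{p}_u,\mathbf{p}_v\}$) is $\mathbf{W}=(\mathbf{J}^T\mathbf{J})^{-1}\mathbf{B}$. Its eigenvalues $\kappa_1,\kappa_2$ are the principal curvatures; with corresponding eigenvectors $\hat{\mathbf{d}}_i$, the principal directions are $\hat{\mathbf{e}}_i=\mathbf{J}\hat{\mathbf{d}}_i/\|\mathbf{J}\hat{\mathbf{d}}_i\|$ (chosen orthogonal to each other when $\kappa_1=\kappa_2$). The (principal) curvature tensor in the local coordinate system is $\mathbf{C}=\kappa_1\hat{\mathbf{e}}_1\hat{\mathbf{e}}_1^T+\kappa_2\hat{\mathbf{e}}_2\hat{\mathbf{e}}_2^T$, and in the global coordinate system it is $\mathbf{C}_g=\mathbf{Q}\mathbf{C}\mathbf{Q}^T$. $\mathbf{M}^+$ denotes the Moore–Penrose pseudo-inverse and $\mathbf{M}^{+T}=(\mathbf{M}^+)^T$. *)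

(* Defs.v *)
From HB Require Import structures.
From mathcomp Require Import all_boot all_order all_algebra.
From mathcomp Require Import all_classical all_reals all_analysis.
Set Implicit Arguments.
Unset Strict Implicit.
Unset Printing Implicit Defensive.
Import Order.TTheory GRing.Theory Num.Theory.
Import numFieldNormedType.Exports.
Local Open Scope classical_set_scope.
Local Open Scope ring_scope.

Section PseudoInverse.
Variable R : realType.

Definition moore_penrose m n (A : 'M[R]_(m, n)) (X : 'M[R]_(n, m)) : Prop :=
  [/\ A *m X *m A = A, X *m A *m X = X,
      (A *m X)^T = A *m X & (X *m A)^T = X *m A].

(* The default value 0 is never used: see mpinvP. *)
Definition mpinv m n (A : 'M[R]_(m, n)) : 'M[R]_(n, m) :=
  xget 0 [set X | moore_penrose A X].

Lemma gram_unitmx m n (A : 'M[R]_(m, n)) : row_free A -> A *m A^T \in unitmx.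
Proof.
move=> fA; rewrite -row_free_unit -kermx_eq0; apply/rowV0P => v.
move/sub_kermxP => vAA0.
have vA0 : v *m A = 0.
  have /matrixP/(_ 0 0) : (v *m A) *m (v *m A)^T = 0.
    by rewrite trmx_mul mulmxA -(mulmxA v) vAA0 mul0mx.
  rewrite !mxE => /eqP; rewrite psumr_eq0 => [/allP h|i _]; last first.
    by rewrite [_^T _ _]mxE -expr2 sqr_ge0.
  apply/rowP => j; have := h j (mem_index_enum j).
  by rewrite [_^T _ _]mxE mulf_eq0 orbb => /eqP ->; rewrite mxE.
by apply: (row_free_inj fA); rewrite vA0 mul0mx.
Qed.

Lemma moore_penrose_unique m n (A : 'M[R]_(m, n)) X Y :
  moore_penrose A X -> moore_penrose A Y -> X = Y.
Proof.
move=> [x1 x2 x3 x4] [y1 y2 y3 y4].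
have eA : A *m X = A *m Y.
  rewrite -[in LHS]y1 -mulmxA -(mulmxA A Y) mulmxA.
  by rewrite -[A *m Y in LHS]y3 -[A *m X]x3 -trmx_mul mulmxA x1.
have eX : X *m A = Y *m A.
  rewrite -[in LHS]y1 -(mulmxA A Y) mulmxA.
  by rewrite -[X *m A]x4 -[Y *m A in LHS]y4 -trmx_mul mulmxA -(mulmxA Y A X)
     -mulmxA x1.
by rewrite -x2 eX -mulmxA eA mulmxA y2.
Qed.

Lemma moore_penrose_factor m n r (B : 'M[R]_(m, r)) (C : 'M[R]_(r, n)) :
  row_full B -> row_free C ->
  moore_penrose (B *m C)
    (C^T *m invmx (C *m C^T) *m (invmx (B^T *m B) *m B^T)).
Proof.
move=> fB /gram_unitmx uC.
have uB : B^T *m B \in unitmx.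
  rewrite -{2}(trmxK B); apply: gram_unitmx.
  by rewrite /row_free mxrank_tr.
set X := _ *m (_ *m B^T).
have AX : B *m C *m X = B *m (invmx (B^T *m B) *m B^T).
  by rewrite /X -!mulmxA (mulmxA C) (mulmxA (C *m _)) mulmxV ?mul1mx.
have XA : X *m (B *m C) = C^T *m invmx (C *m C^T) *m C.
  by rewrite /X -!mulmxA (mulmxA B^T) (mulmxA (invmx (_ *m B))) mulVmx ?mul1mx.
split.
- by rewrite AX -!mulmxA (mulmxA B^T) (mulmxA (invmx _)) mulVmx ?mul1mx.
- by rewrite XA /X -!mulmxA (mulmxA C) (mulmxA (C *m _)) mulmxV ?mul1mx.
- by rewrite AX !trmx_mul trmxK trmx_inv trmx_mul trmxK mulmxA.
- by rewrite XA !trmx_mul trmxK trmx_inv trmx_mul trmxK mulmxA.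
Qed.

Lemma mpinvP m n (A : 'M[R]_(m, n)) : moore_penrose A (mpinv A).
Proof.
apply: (xgetPex 0); rewrite -[A]mulmx_base; eexists.
exact: moore_penrose_factor (col_base_full A) (row_base_free A).
Qed.

End PseudoInverse.

Section HeightFunction.
Variable R : realType.
Implicit Types (f : 'cV[R]_2 -> R) (p : 'cV[R]_2).

Definition partial (V : normedModType R) (i : 'I_2) (g : 'cV[R]_2 -> V) :
  'cV[R]_2 -> V := fun p => 'D_(delta_mx i 0) g p.

Definition smooth_on (U : set 'cV[R]_2) f : Prop :=
  forall (s : seq 'I_2) p, U p ->
    let g := foldr (fun i => partial i) f s in
    (forall i, derivable g p (delta_mx i 0)) /\ {for p, continuous g}.

Definition graph_param f : 'cV[R]_2 -> 'cV[R]_3 :=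
  fun p => \col_(i < 3) [:: p 0 0; p 1 0; f p]`_i.

(* The columns are p_u and p_v. *)
Definition jacobian_graph f p : 'M[R]_(3, 2) :=
  \matrix_(i < 3, j < 2) partial j (graph_param f) p i 0.

Definition hessian f p : 'M[R]_2 :=
  \matrix_(i < 2, j < 2) partial i (partial j f) p.

Definition ell f p : R :=
  Num.sqrt (1 + partial 0 f p ^+ 2 + partial 1 f p ^+ 2).

Definition second_form f p : 'M[R]_2 := (ell f p)^-1 *: hessian f p.

Definition weingarten f p : 'M[R]_2 :=
  let J := jacobian_graph f p in invmx (J^T *m J) *m second_form f p.

(* The library norm `|v| on matrices is the sup norm. *)
Definition enorm n (v : 'cV[R]_n) : R := Num.sqrt (\sum_i v i 0 ^+ 2).

Definition normalize n (v : 'cV[R]_n) : 'cV[R]_n := (enorm v)^-1 *: v.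

(* k1, k2 are the eigenvalues of W counted with algebraic multiplicity. *)
Definition principal_data f p (k1 k2 : R) (e1 e2 : 'cV[R]_3) : Prop :=
  let W := weingarten f p in
  let J := jacobian_graph f p in
  char_poly W = ('X - k1%:P) * ('X - k2%:P) /\
  exists d1 d2 : 'cV[R]_2,
    [/\ d1 != 0 /\ W *m d1 = k1 *: d1,
        d2 != 0 /\ W *m d2 = k2 *: d2,
        e1 = normalize (J *m d1),
        e2 = normalize (J *m d2) &
        k1 = k2 -> e1^T *m e2 = 0].

Definition is_curvature_tensor f p (C : 'M[R]_3) : Prop :=
  exists k1 k2 e1 e2, principal_data f p k1 k2 e1 e2 /\
    C = k1 *: (e1 *m e1^T) + k2 *: (e2 *m e2^T).

End HeightFunction.

(* The translation part x0 of the change of coordinates u |-> Q *m u + x0 does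
   not act on tensors. *)
Definition to_global (R : realType) (Q C : 'M[R]_3) : 'M[R]_3 :=
  Q *m C *m Q^T.

Definition mpinv_formula (R : realType) (l fu fv : R) : 'M[R]_(2, 3) :=
  (l ^+ 2)^-1 *: \matrix_(i < 2, j < 3)
    (nth [::] [:: [:: 1 + fv ^+ 2; - (fu * fv); fu];
                  [:: - (fu * fv); 1 + fu ^+ 2; fv]] i)`_j.

(* Main.v *)
(* Write G = J^T J and W = G^-1 B. Equality of mixed partials makes B
   symmetric, so W is self-adjoint for the inner product given by G; hence
   principal data exist, and the normalised eigenvectors c_i of W are
   G-orthonormal. Orthonormality says c_1 c_1^T + c_2 c_2^T = G^-1, whence
   C = J (k_1 c_1 c_1^T + k_2 c_2 c_2^T) J^T = J W G^-1 J^T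
     = (J G^-1) B (G^-1 J^T),
   and G^-1 J^T is the pseudo-inverse of J. *)
Require Import Defs.
From HB Require Import structures.
From mathcomp Require Import all_boot all_order all_algebra.
From mathcomp Require Import all_classical all_reals all_analysis.
From mathcomp Require Import ring lra.
Import Order.TTheory GRing.Theory Num.Theory.
Import numFieldNormedType.Exports.
Local Open Scope classical_set_scope.
Local Open Scope ring_scope.

(** * Equality of mixed directional derivatives (Schwarz) *)

Section MixedPartials.
Context {R : realType} {V : normedModType R}.
Implicit Types (f : V -> R) (p u v : V).

(** Restriction to a line makes the mean value theorem in one real variable available for
    directional derivatives. *)
Lemma is_derive_line {f p u} (t : R) :
  derivable f (p + t *: u) u ->
  is_derive t 1 (fun s => f (p + s *: u)) ('D_u f (p + t *: u)).
Proof.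
have E : (fun h : R => h^-1 *: (((fun s => f (p + s *: u)) \o shift t) (h *: 1)
            - f (p + t *: u))) =
    (fun h => h^-1 *: ((f \o shift (p + t *: u)) (h *: u) - f (p + t *: u))).
  apply/funext => h /=; congr (_ *: (f _ - _)).
  by rewrite [h *: 1]mulr1 scalerDl addrCA.
by move=> df; split; rewrite /derivable /derive E.
Qed.

(** The mean value theorem is applied twice: to the increment [phi] along [u], whose own increment
    over [0, h] is the second difference, then to ['D_u f] along [v]. *)
Lemma second_difference f p u v (h : R) : 0 < h ->
  (forall s t, 0 <= s <= h -> 0 <= t <= h ->
     derivable f (p + s *: u + t *: v) u /\
     derivable ('D_u f) (p + s *: u + t *: v) v) ->
  exists s t, [/\ 0 <= s <= h, 0 <= t <= h &
    f (p + h *: u + h *: v) - f (p + h *: u) - f (p + h *: v) + f p =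
      h ^+ 2 * 'D_v ('D_u f) (p + s *: u + t *: v)].
Proof.
move=> h0 df.
pose phi s := f ((p + h *: v) + s *: u) - f (p + s *: u).
have dphi s : s \in `[0, h] ->
    is_derive s 1 phi
      ('D_u f ((p + h *: v) + s *: u) - 'D_u f (p + s *: u)).
  rewrite in_itv /= => sh; apply: is_deriveB; apply: is_derive_line.
    by rewrite addrAC; case: (df s h sh) => //; rewrite lexx ltW.
  by have := df s 0 sh; rewrite scale0r addr0 lexx ltW// => /(_ isT)[].
have [|s /[!in_itv]/= sh phiE] := @MVT R phi _ 0 h h0 (fun s sh => dphi s (subset_itv_oo_cc sh)).
- by apply: derivable_within_continuous => s /dphi.
have {}sh : 0 <= s <= h by case/andP: sh => /ltW-> /ltW->.
pose psi t := 'D_u f ((p + s *: u) + t *: v).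
have dpsi t : t \in `[0, h] ->
    is_derive t 1 psi ('D_v ('D_u f) ((p + s *: u) + t *: v)).
  by rewrite in_itv /= => th; apply: is_derive_line; case: (df s t sh th).
have [|t /[!in_itv]/= th psiE] := @MVT R psi _ 0 h h0 (fun t th => dpsi t (subset_itv_oo_cc th)).
- by apply: derivable_within_continuous => t /dpsi.
have {}th : 0 <= t <= h by case/andP: th => /ltW-> /ltW->.
exists s, t; split => //.
move: phiE psiE; rewrite /phi /psi !scale0r !addr0 !subr0.
rewrite (addrAC p (h *: v)) (addrAC p (h *: v)) => phiE psiE.
have -> : h ^+ 2 * 'D_v ('D_u f) (p + s *: u + t *: v) =
    'D_v ('D_u f) (p + s *: u + t *: v) * h * h by ring.
by rewrite -psiE -phiE; ring.
Qed.

Lemma near_parallelogram p u v (P : set V) : (\forall q \near p, P q) ->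
  exists2 h : R, 0 < h &
    forall s t, 0 <= s <= h -> 0 <= t <= h -> P (p + s *: u + t *: v).
Proof.
case/nbhs_ballP => e /= e0 Pe.
have N0 : 0 < `|u| + `|v| + 1 by rewrite ltr_wpDl ?addr_ge0.
(* The added 1 keeps the denominator positive and makes the bound by [e] strict. *)
exists (e / (`|u| + `|v| + 1)); first exact: divr_gt0.
set h := e / _ => s t /andP[s0 sh] /andP[t0 th]; apply: Pe.
rewrite -ball_normE /ball_ /= -addrA opprD addNKr normrN.
rewrite (le_lt_trans (ler_normD _ _))// !normrZ !ger0_norm//.
have -> : e = h * (`|u| + `|v| + 1) by rewrite divfK ?gt_eqF.
have h0 : 0 < h by exact: divr_gt0.
have := ler_wpM2r (normr_ge0 u) sh; have := ler_wpM2r (normr_ge0 v) th.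
rewrite !mulrDr mulr1; lra.
Qed.

(** The second difference is symmetric in [u] and [v], so both mixed derivatives take a common value
    at points of one small parallelogram; by continuity their values at [p] differ by at most any
    [e > 0]. *)
Lemma derive_comm f p u v :
  (\forall q \near p, [/\ derivable f q u, derivable f q v,
     derivable ('D_u f) q v & derivable ('D_v f) q u]) ->
  {for p, continuous ('D_v ('D_u f))} -> {for p, continuous ('D_u ('D_v f))} ->
  'D_v ('D_u f) p = 'D_u ('D_v f) p.
Proof.
move=> df cvu cuv; apply/eqP; rewrite -subr_eq0 -normr_le0.
apply/ler_addgt0Pr => e e0; rewrite add0r.
have e2 : 0 < e / 2 by rewrite divr_gt0.
have /near_parallelogram-/(_ u v)[h h0 Ph] : \forall q \near p,
  [/\ derivable f q u, derivable f q v,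
     derivable ('D_u f) q v & derivable ('D_v f) q u] /\
  (`|'D_v ('D_u f) p - 'D_v ('D_u f) q| < e / 2 /\
  `|'D_u ('D_v f) p - 'D_u ('D_v f) q| < e / 2).
  apply: filterI df _; apply: filterI.
    by move/cvgrPdist_lt : cvu; apply.
  by move/cvgrPdist_lt : cuv; apply.
have [|s [t [sh th E]]] := @second_difference f p u v h h0.
  by move=> s t sh th; have [[]] := Ph s t sh th.
have [|t' [s' [th' sh' E']]] := @second_difference f p v u h h0.
  by move=> x y xh yh; have [[]] := Ph y x yh xh; rewrite addrAC.
have [_ [A _]] := Ph s t sh th; have [_ [_ B]] := Ph s' t' sh' th'.
(* Times [h ^+ 2], both sides are the same second difference. *)
have {E E'}AB : 'D_v ('D_u f) (p + s *: u + t *: v) =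
    'D_u ('D_v f) (p + s' *: u + t' *: v).
  apply: (mulfI (expf_neq0 2 (lt0r_neq0 h0))).
  rewrite (addrAC p (s' *: u)); apply: etrans (esym E) (etrans _ E').
  by rewrite (addrAC p (h *: v)) (addrAC (f _)).
move: A B; rewrite AB.
move: ('D_v _ p) ('D_u _ p) ('D_u _ _) => x y z xz yz.
rewrite -(subrKA z) (splitr e) (le_trans (ler_normD _ _))// lerD ?(ltW xz)//.
by rewrite distrC ltW.
Qed.

End MixedPartials.

(** * Determinants, Euclidean norms and pseudo-inverses under orthogonal maps *)

Lemma det_mx22 (A : comNzRingType) (M : 'M[A]_2) :
  \det M = M 0 0 * M 1 1 - M 0 1 * M 1 0.
Proof.
rewrite (expand_det_row _ 0) !big_ord_recl big_ord0 addr0 /cofactor !det_mx11.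
rewrite !mxE /= addn0 expr0 expr1 mul1r mulN1r mulrN.
by congr (M _ _ * M _ _ - M _ _ * M _ _); apply/val_inj.
Qed.

Lemma enorm_sqr (R : realType) n (v : 'cV[R]_n) : v^T *m v = (enorm v ^+ 2)%:M.
Proof.
rewrite [LHS]mx11_scalar mxE sqr_sqrtr; last by apply: sumr_ge0 => i _; exact: sqr_ge0.
by congr _%:M; apply: eq_bigr => i _; rewrite mxE expr2.
Qed.

Lemma enorm_eq0 (R : realType) n (v : 'cV[R]_n) : (enorm v == 0) = (v == 0).
Proof.
apply/eqP/eqP => [v0|->].
  have : \sum_i v i 0 ^+ 2 = 0.
    rewrite -(@sqr_sqrtr _ (\sum_i _)) ?sumr_ge0// => [|i _]; last exact: sqr_ge0.
    by rewrite -/(enorm v) v0 expr0n.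
  move/eqP; rewrite psumr_eq0 => [/allP h|i _]; last exact: sqr_ge0.
  apply/colP => i; apply/eqP; rewrite mxE -sqrf_eq0.
  exact: h (mem_index_enum i).
by rewrite /enorm big1 ?sqrtr0// => i _; rewrite mxE expr0n.
Qed.

(** [Q^T Q = 1] cancels inside one product, leaving [X A]; the other becomes the conjugate
    [Q (A X) Q^T], still symmetric. *)
Lemma moore_penrose_orthogonal (R : realType) m n (A : 'M[R]_(m, n))
    (Q : 'M[R]_m) X :
  Q^T *m Q = 1%:M -> moore_penrose A X -> moore_penrose (Q *m A) (X *m Q^T).
Proof.
move=> QQ [h1 h2 h3 h4].
have XA : X *m Q^T *m (Q *m A) = X *m A by rewrite -mulmxA (mulmxA Q^T) QQ mul1mx.
split; rewrite ?XA //.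
- by rewrite -mulmxA XA -mulmxA (mulmxA A) h1.
- by rewrite mulmxA h2.
- by rewrite -(mulmxA Q) (mulmxA A) !trmx_mul trmxK -trmx_mul h3 !mulmxA.
Qed.

(** * Eigenvectors of a matrix self-adjoint for a 2 x 2 inner product *)

Section SelfAdjoint.
Context {R : realType}.

(* [G 0 0 * disc (char_poly W)] is the value of the quadratic form [G] at
   [(W 0 0 - W 1 1, 2 * W 1 0)], hence nonnegative; when it vanishes, [W] is
   scalar. *)
Lemma selfadjoint_eigen (G W : 'M[R]_2) :
  G^T = G -> (G *m W)^T = G *m W -> 0 < G 0 0 -> 0 < \det G ->
  exists k1 k2 (d1 d2 : 'cV[R]_2),
    [/\ char_poly W = ('X - k1%:P) * ('X - k2%:P),
        d1 != 0 /\ W *m d1 = k1 *: d1, d2 != 0 /\ W *m d2 = k2 *: d2 &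
        k1 = k2 -> d1^T *m G *m d2 = 0].
Proof.
move=> /matrixP/(_ 0 1) /[!mxE] Gs /matrixP/(_ 0 1).
rewrite !mxE !big_ord_recl !big_ord0 !addr0.
have -> : lift ord0 ord0 = 1 :> 'I_2 by apply/val_inj.
rewrite det_mx22 Gs.
set a := W 0 0; set b := W 0 1; set c := W 1 0; set d := W 1 1.
set E := G 0 0; set F := G 0 1; set H := G 1 1 => GWs E0 D0.
(* [E] times the form [G] at (a - d, 2c), with the square completed; the symmetry [GWs] of [G W]
   eliminates [b]. *)
have discE : E * (E * ((a - d) ^+ 2 + 4 * b * c)) =
    (E * (a - d) + 2 * F * c) ^+ 2 + 4 * (E * H - F * F) * c ^+ 2.
  have -> : E * (E * ((a - d) ^+ 2 + 4 * b * c)) =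
    (E * (a - d)) ^+ 2 + 4 * E * c * (E * b) by ring.
  have -> : E * b = F * a + H * c - F * d by rewrite GWs; ring.
  ring.
have disc0 : 0 <= (a - d) ^+ 2 + 4 * b * c.
  rewrite -(pmulr_rge0 _ E0) -(pmulr_rge0 _ E0) discE.
  by rewrite addr_ge0 ?sqr_ge0// mulr_ge0 ?sqr_ge0// mulr_ge0// ltW.
set r := Num.sqrt ((a - d) ^+ 2 + 4 * b * c).
have r2 : r ^+ 2 = (a - d) ^+ 2 + 4 * b * c by rewrite sqr_sqrtr.
(* Quadratic formula: [a + d] is the trace and [r ^+ 2] is the squared trace minus four times the
   determinant. *)
have cpE : char_poly W =
    ('X - ((a + d + r) / 2)%:P) * ('X - ((a + d - r) / 2)%:P).
  rewrite /char_poly det_mx22 !mxE /= !mulr0n !mulr1n !sub0r mulrNN.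
  have -> : ('X - ((a + d + r) / 2)%:P) * ('X - ((a + d - r) / 2)%:P) =
    'X^2 - ((a + d + r) / 2 + (a + d - r) / 2)%:P * 'X
     + ((a + d + r) / 2 * ((a + d - r) / 2))%:P.
    by rewrite polyCD polyCM; ring.
  have -> : (a + d + r) / 2 + (a + d - r) / 2 = a + d by field.
  have -> : (a + d + r) / 2 * ((a + d - r) / 2) = a * d - b * c.
    have -> : (a + d + r) / 2 * ((a + d - r) / 2) = ((a + d) ^+ 2 - r ^+ 2) / 4.
      by field.
    by rewrite r2; field.
  by rewrite polyCB !polyCM polyCD; ring.
have eigen k : root (char_poly W) k -> exists2 v : 'cV_2, v != 0 & W *m v = k *: v.
  (* [eigenvalue] concerns row vectors, hence the passage to [W^T], which has the same
     characteristic polynomial. *)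
  move=> rk; have : eigenvalue W^T k.
    by rewrite eigenvalue_root_char /char_poly -det_tr /char_poly_mx linearB /=
      tr_scalar_mx -map_trmx trmxK.
  case/eigenvalueP => v vW v0; exists v^T; first by rewrite trmx_eq0.
  by apply: trmx_inj; rewrite trmx_mul linearZ /= trmxK.
have [r0|r0] := eqVneq r 0.
  (* Both nonnegative terms of [discE] vanish: the second gives [c = 0], then the first gives
     [a = d]. *)
  have : E * (E * ((a - d) ^+ 2 + 4 * b * c)) = 0.
    by rewrite -r2 r0 expr0n !mulr0.
  rewrite discE => /eqP; rewrite paddr_eq0 ?sqr_ge0//; last first.
    by rewrite mulr_ge0 ?sqr_ge0// mulr_ge0// ltW.
  rewrite sqrf_eq0 => /andP[/eqP x0].
  rewrite mulf_eq0 sqrf_eq0 mulf_eq0 pnatr_eq0 (gt_eqF D0) /= => /eqP c0.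
  move: x0; rewrite c0 mulr0 addr0 => /eqP; rewrite mulf_eq0 (gt_eqF E0) subr_eq0 /=.
  move=> /eqP ad.
  have b0 : b = 0.
    apply: (mulfI (lt0r_neq0 E0)); rewrite mulr0.
    by move: GWs; rewrite c0 ad; lra.
  have Wa : W = a%:M.
    apply/matrixP => i j; rewrite !mxE.
    case: i => -[|[|//]] hi; case: j => -[|[|//]] hj; rewrite /= ?mulr1n ?mulr0n;
    [rewrite /a|rewrite -b0 /b|rewrite -c0 /c|rewrite ad /d];
    by congr (W _ _); apply/val_inj.
  (* Every nonzero vector is an eigenvector; (-F, E) is [G]-orthogonal to (1, 0). *)
  exists a, a, (\col_i [:: 1; 0]`_i), (\col_i [:: - F; E]`_i).
  have eW v : W *m v = a *: v by rewrite Wa mul_scalar_mx.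
  split => //; first last.
  - move=> _; apply/matrixP => i j; rewrite !mxE !big_ord_recl !big_ord0 !mxE.
    rewrite !big_ord_recl !big_ord0 !mxE /=.
    have -> : lift ord0 ord0 = 1 :> 'I_2 by apply/val_inj.
    by rewrite -/E -/F; ring.
  - split=> //; apply/eqP => /matrixP/(_ 1 0); rewrite !mxE /= => /eqP.
    by rewrite (gt_eqF E0).
  - split=> //; apply/eqP => /matrixP/(_ 0 0); rewrite !mxE /= => /eqP.
    by rewrite oner_eq0.
  - rewrite cpE r0 ad addr0 subr0.
    by have -> : (d + d) / 2 = d by field.
have [|d1 d10 W1] := eigen ((a + d + r) / 2).
  by rewrite cpE rootM root_XsubC eqxx.
have [|d2 d20 W2] := eigen ((a + d - r) / 2).
  by rewrite cpE rootM !root_XsubC eqxx orbT.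
exists ((a + d + r) / 2), ((a + d - r) / 2), d1, d2; split => //.
(* Equal eigenvalues would force [r = 0], so the orthogonality clause is vacuous here. *)
by move=> kk; case/eqP: r0; lra.
Qed.

(** The algebraic core: [X^T B X = J (W G^-1) J^T], and expanding [G^-1] in the [G]-orthonormal
    eigenvectors diagonalises [W]. *)
Lemma curvature_tensorE n (J : 'M[R]_(n, 2)) (B : 'M[R]_2) k1 k2
    (d1 d2 : 'cV[R]_2) :
  let W := invmx (J^T *m J) *m B in
  let X := invmx (J^T *m J) *m J^T in
  let e1 := normalize (J *m d1) in let e2 := normalize (J *m d2) in
  J^T *m J \in unitmx -> B^T = B ->
  d1 != 0 -> W *m d1 = k1 *: d1 -> d2 != 0 -> W *m d2 = k2 *: d2 ->
  (k1 = k2 -> e1^T *m e2 = 0) ->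
  k1 *: (e1 *m e1^T) + k2 *: (e2 *m e2^T) = X^T *m B *m X.
Proof.
move=> W X e1 e2; set G := J^T *m J => uG Bs d10 W1 d20 W2 orth.
have Gs : G^T = G by rewrite trmx_mul trmxK.
have BE : B = G *m W by rewrite mulKVmx.
have XJ : X *m J = 1%:M by rewrite -mulmxA mulVmx.
have normE d : normalize (J *m d) = J *m ((enorm (J *m d))^-1 *: d).
  by rewrite -scalemxAr.
have unit_len d : d != 0 -> (normalize (J *m d))^T *m normalize (J *m d) = 1%:M.
  (* [X] is a left inverse of [J], so [J d] is nonzero and can be normalised. *)
  move=> d0; have N0 : enorm (J *m d) != 0.
    rewrite enorm_eq0; apply: contraNneq d0 => Jd0.
    by rewrite -[d]mul1mx -XJ -mulmxA Jd0 mulmx0.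
  rewrite /normalize -scalemxAr linearZ /= -scalemxAl enorm_sqr scalerA.
  by rewrite scale_scalar_mx -expr2 -exprMn mulVf ?expr1n.
have e12 : e1^T *m e2 = 0.
  have [/orth//|kk] := eqVneq k1 k2.
  rewrite /e1 /e2 /normalize -scalemxAr linearZ /= -scalemxAl.
  suff -> : (J *m d1)^T *m (J *m d2) = 0 by rewrite !scaler0.
  rewrite trmx_mul -mulmxA (mulmxA J^T) -/G.
  (* Both sides equal [d1^T B d2], since [B = G W] is symmetric. *)
  have : k1 *: (d1^T *m (G *m d2)) = k2 *: (d1^T *m (G *m d2)).
    rewrite scalemxAl -linearZ /= -W1 !scalemxAr -W2 trmx_mul.
    rewrite (mulmxA G) -BE -mulmxA (mulmxA W^T).
    by rewrite -[X in W^T *m X]Gs -trmx_mul -BE Bs.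
  by move/eqP; rewrite -subr_eq0 -scalerBl scaler_eq0 subr_eq0 (negPf kk) => /eqP.
have [e11 e22] := (unit_len d1 d10, unit_len d2 d20).
rewrite -/e1 in e11; rewrite -/e2 in e22.
have e21 : e2^T *m e1 = 0 by rewrite -[LHS]trmxK trmx_mul trmxK e12 trmx0.
move: e11 e12 e21 e22; rewrite /e1 /e2 !normE.
(* The normalising factors now sit inside: [e1 = J c1] and [e2 = J c2]. *)
set c1 := _ *: d1; set c2 := _ *: d2 => e11 e12 e21 e22.
have Wc1 : W *m c1 = k1 *: c1 by rewrite -scalemxAr W1 scalerA mulrC -scalerA.
have Wc2 : W *m c2 = k2 *: c2 by rewrite -scalemxAr W2 scalerA mulrC -scalerA.
pose D : 'M[R]_(2, 1 + 1) := row_mx c1 c2.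
have DD : D *m D^T = c1 *m c1^T + c2 *m c2^T by rewrite tr_row_mx mul_row_col.
have DGD : (J *m D)^T *m (J *m D) = 1%:M.
  rewrite mul_mx_row tr_row_mx mul_col_row e11 e12 e21 e22.
  by rewrite -scalar_mx_block.
(* [D^T G D = 1] and [D] is square, so [D^T] is also a right inverse of [G D]. *)
have {}DD : invmx G = c1 *m c1^T + c2 *m c2^T.
  rewrite -DD -[LHS]mulmx1 -[RHS](mulKmx uG); congr (_ *m _); apply/esym.
  rewrite mulmxA; apply: (@mulmx1C _ 2); rewrite -[RHS]DGD trmx_mul -!mulmxA.
  by rewrite (mulmxA J^T).
have -> : X^T *m B *m X = J *m (W *m invmx G) *m J^T.
  by rewrite /X trmx_mul trmxK trmx_inv Gs /W !mulmxA.
rewrite DD !mulmxDr mulmxDl !(mulmxA W) Wc1 Wc2 !trmx_mul.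
by rewrite -!scalemxAl -!scalemxAr -!scalemxAl !mulmxA.
Qed.

End SelfAdjoint.

(** * Jacobian, Hessian and Gram matrix of a graph *)

Section Surface.
Context {R : realType}.
Implicit Types (f : 'cV[R]_2 -> R) (p : 'cV[R]_2).

Lemma jacobian_graphE f p : (forall i : 'I_2, derivable f p (delta_mx i 0)) ->
  jacobian_graph f p = \matrix_(i < 3, j < 2)
    (nth [::] [:: [:: 1; 0]; [:: 0; 1]; [:: partial 0 f p; partial 1 f p]] i)`_j.
Proof.
move=> df.
have dcoord (k j : 'I_2) :
    is_derive p (delta_mx j 0) (fun q : 'cV[R]_2 => q k 0) (k == j)%:R.
  suff cv : (fun h : R => h^-1 *: (((fun q : 'cV[R]_2 => q k 0) \o shift p)
      (h *: delta_mx j 0) - p k 0)) @ 0^' --> ((k == j)%:R : R).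
    by split; [apply/cvg_ex; exists (k == j)%:R|exact: cvg_lim cv].
  (* For [h] nonzero the difference quotient of a coordinate is exactly the Kronecker delta. *)
  apply: cvg_near_cst; near=> h.
  have h0 : h != 0 by near: h; exact: nbhs_dnbhs_neq.
  by rewrite /= !mxE eqxx andbT addrK [LHS]mulKf.
have dgraph (i : 'I_3) (j : 'I_2) : is_derive p (delta_mx j 0)
    (fun q => graph_param f q i 0)
    (nth [::] [:: [:: 1; 0]; [:: 0; 1]; [:: partial 0 f p; partial 1 f p]] i)`_j.
  have -> : (fun q => graph_param f q i 0) =
      (fun q : 'cV[R]_2 => [:: q 0 0; q 1 0; f q]`_i).
    by apply/funext => q; rewrite mxE.
  have [->|->] : j = 0 \/ j = 1.
    by case: j => -[|[|//]] hj; [left|right]; apply/val_inj.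
    by case: i => -[|[|[|//]]] hi /=; [exact: dcoord|exact: dcoord|exact: DeriveDef].
  by case: i => -[|[|[|//]]] hi /=; [exact: dcoord|exact: dcoord|exact: DeriveDef].
apply/matrixP => i j; rewrite !mxE /partial derive_mx ?mxE.
  exact: derive_val.
by apply/derivable_mxP => k l; rewrite ord1; apply: ex_derive.
Unshelve. all: by end_near. Qed.

(** In [smooth_on], lists of length at most one give the derivability that [derive_comm] needs near
    [p], and lists of length two the continuity at [p]. *)
Lemma hessian_sym (U : set 'cV[R]_2) f p :
  open U -> smooth_on U f -> U p -> (hessian f p)^T = hessian f p.
Proof.
move=> oU sf Up; apply/matrixP => i j; rewrite !mxE.
have df q k l : U q -> derivable f q (delta_mx k 0) /\
    derivable (partial l f) q (delta_mx k 0).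
  by move=> Uq; split; [have [] := sf [::] q Uq|have [] := sf [:: l] q Uq].
apply: derive_comm.
- have : \forall q \near p, U q by exact: open_nbhs_nbhs.
  apply: filterS => q Uq.
  have [fi fij] := df q i j Uq; have [fj fji] := df q j i Uq.
  by split; [exact: fi|exact: fj|exact: fji|exact: fij].
- by have [_] := sf [:: j; i] p Up.
- by have [_] := sf [:: i; j] p Up.
Qed.

Lemma gram_graph f p : (forall i : 'I_2, derivable f p (delta_mx i 0)) ->
  let J := jacobian_graph f p in
  let fu := partial 0 f p in let fv := partial 1 f p in
  J^T *m J = \matrix_(i < 2, j < 2)
    (nth [::] [:: [:: 1 + fu ^+ 2; fu * fv]; [:: fu * fv; 1 + fv ^+ 2]] i)`_j.
Proof.
move=> /(jacobian_graphE f p) -> /=.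
apply/matrixP => -[[|[|//]] hi] [[|[|//]] hj];
rewrite !mxE !big_ord_recl big_ord0 !mxE /=; ring.
Qed.

(** The right-hand side is a left inverse of [J], which settles three Penrose conditions; symmetry
    of the Gram matrix gives the fourth. *)
Lemma mpinv_gram m n (J : 'M[R]_(m, n)) :
  J^T *m J \in unitmx -> mpinv J = invmx (J^T *m J) *m J^T.
Proof.
move=> uG; apply: moore_penrose_unique (mpinvP J) _.
have XJ : invmx (J^T *m J) *m J^T *m J = 1%:M by rewrite -mulmxA mulVmx.
split; rewrite ?XJ ?mul1mx ?trmx1 //.
- by rewrite -mulmxA XJ mulmx1.
- by rewrite !trmx_mul trmxK trmx_inv trmx_mul trmxK mulmxA.
Qed.

End Surface.

(** * The curvature tensor of a graph in local and global coordinates *)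

Theorem theorem2 (R : realType) (U : set 'cV[R]_2) (f : 'cV[R]_2 -> R)
    (p : 'cV[R]_2) (Q : 'M[R]_3)
    (U_open : open U) (f_smooth : smooth_on U f) (Up : U p)
    (Q_orth : Q^T *m Q = 1%:M) :
  let l := ell f p in
  let H := hessian f p in
  let B := second_form f p in
  let J := jacobian_graph f p in
  let Jg := Q *m J in
  [/\ mpinv J = mpinv_formula l (partial 0 f p) (partial 1 f p),
      mpinv Jg = mpinv J *m Q^T,
      exists C, is_curvature_tensor f p C &
      forall C, is_curvature_tensor f p C ->
        let Cg := to_global Q C in
        [/\ C = (mpinv J)^T *m B *m mpinv J /\
            C = l^-1 *: ((mpinv J)^T *m H *m mpinv J),
            Cg = (mpinv Jg)^T *m B *m mpinv Jg /\
            Cg = l^-1 *: ((mpinv Jg)^T *m H *m mpinv Jg),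
            H = l *: (J^T *m C *m J) &
            H = l *: (Jg^T *m Cg *m Jg)]].
Proof.
move=> l H B J Jg.
have df i : derivable f p (delta_mx i 0) by have [] := f_smooth [::] p Up.
have GE := gram_graph f p df; rewrite /= -/J in GE.
set G := J^T *m J in GE; set fu := partial 0 f p in GE *; set fv := partial 1 f p in GE *.
have l2 : l ^+ 2 = 1 + fu ^+ 2 + fv ^+ 2.
  by rewrite sqr_sqrtr// !addr_ge0 ?sqr_ge0.
have l2_gt0 : 0 < l ^+ 2.
  by rewrite l2 -addrA ltr_wpDr// addr_ge0 ?sqr_ge0.
have l_neq0 : l != 0 by rewrite -sqrf_eq0 gt_eqF.
have detG : \det G = l ^+ 2.
  by rewrite det_mx22 GE !mxE /= l2; ring.
have uG : G \in unitmx by rewrite unitmxE detG unitfE gt_eqF.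
have Bs : B^T = B by rewrite /B /second_form linearZ /= (hessian_sym U f p).
have mpJ := mpinv_gram _ _ J uG.
have XJ : mpinv J *m J = 1%:M by rewrite mpJ -mulmxA mulVmx.
have JX : J^T *m (mpinv J)^T = 1%:M by rewrite -trmx_mul XJ trmx1.
have mpJg : mpinv Jg = mpinv J *m Q^T.
  exact: moore_penrose_unique (mpinvP _) (moore_penrose_orthogonal R _ _ J Q _ Q_orth (mpinvP J)).
split=> //.
(* Multiplied by [G] and [l ^+ 2], the formula becomes a polynomial identity in [fu] and [fv]. *)
- rewrite mpJ; apply: (can_inj (mulKmx uG)); rewrite mulKVmx //.
  rewrite /mpinv_formula -scalemxAr; apply: (scalerI (lt0r_neq0 l2_gt0)).
  rewrite scalerA divff ?gt_eqF// scale1r GE /J jacobian_graphE // -/fu -/fv l2.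
  apply/matrixP => -[[|[|//]] hi] [[|[|[|//]]] hj];
  rewrite !mxE !big_ord_recl big_ord0 !mxE /=; ring.
(* Existence: [G (G^-1 B) = B] is symmetric, so the Weingarten matrix is self-adjoint for [G]. *)
- have [||||k1 [k2 [d1 [d2 [cW W1 W2 orth]]]]] := @selfadjoint_eigen R G (invmx G *m B).
  + by rewrite trmx_mul trmxK.
  + by rewrite mulKVmx.
  + by rewrite GE !mxE /= ltr_wpDr ?sqr_ge0.
  + by rewrite detG.
  eexists; exists k1, k2, (normalize (J *m d1)), (normalize (J *m d2)).
  split; [split=> //; exists d1, d2; split=> //|reflexivity].
  (* [G]-orthogonality of [d1], [d2] is Euclidean orthogonality of [J d1], [J d2]. *)
  move=> /orth GO; rewrite /normalize -scalemxAr linearZ /= -scalemxAl trmx_mul.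
  by rewrite -mulmxA (mulmxA J^T) -/G mulmxA GO !scaler0.
(* Every choice of principal data leads to the same tensor. *)
move=> C [k1 [k2 [e1 [e2 [[_ [d1 [d2 [[d10 W1] [d20 W2] -> -> orth]]]] CE]]]]].
have {}CE : C = (mpinv J)^T *m B *m mpinv J.
  by rewrite CE mpJ; exact: curvature_tensorE.
have HB : H = l *: B by rewrite scalerA divff// scale1r.
have CgE : to_global Q C = (mpinv Jg)^T *m B *m mpinv Jg.
  by rewrite mpJg /to_global CE trmx_mul trmxK !mulmxA.
have JCJ : J^T *m C *m J = B.
  by rewrite CE -!mulmxA XJ mulmx1 mulmxA JX mul1mx.
split=> //.
- by split=> //; rewrite HB -scalemxAr -scalemxAl scalerA mulVf// scale1r.
- by split=> //; rewrite HB -scalemxAr -scalemxAl scalerA mulVf// scale1r.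
- by rewrite JCJ.
(* [Q^T Q = 1] reduces the global identity to the local one. *)
- rewrite /to_global trmx_mul -!mulmxA !(mulmxA Q^T) Q_orth !mul1mx.
  by rewrite (mulmxA J^T) JCJ.
Qed.
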